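(* Let $E=TM\oplus T^*M\oplus\mathcal G$ be a standard Courant algebroid and let $\mathcal J$ be a generalised almost complex structure on $E$ with components $J,A,B,C,\mu,\nu$. If $\mathcal J$ is integrable, then $B\in\Gamma(\bigwedge^2TM)$ is a Poisson bivector.
   Context: $M$ is a connected smooth manifold. A quadratic Lie algebra bundle $(\mathcal G,[\cdot,\cdot]_{\mathcal G},\langle\cdot,\cdot\rangle_{\mathcal G})$ is a vector bundle over $M$ whose fibres are smoothly varying Lie algebras with ad-invariant non-degenerate symmetric bilinear form. A standard Courant algebroid is $E=TM\oplus T^*M\oplus\mathcal G$ with data $(\nabla,R,H)$, where $\nabla$ is a connection on $\mathcal G$ preserving $[\cdot,\cdot]_{\mathcal G}$ and $\langle\cdot,\cdot\rangle_{\mathcal G}$, $R\in\Omega^2(M,\mathcal G)$, $H\in\Omega^3(M)$, $R^\nabla(X,Y)r=[R(X,Y),r]_{\mathcal G}$, $d^\nabla R=0$, $dH=\langle R\wedge R\rangle_{\mathcal G}$ ($\langle R\wedge R\rangle_{\mathcal G}(X,Y,Z,V)=2\sum_{\mathrm{cycl}(X,Y,Z)}\langle R(X,Y),R(Z,V)\rangle_{\mathcal G}$). Anchor: projection $\pi:E\to TM$. Scalar product: $\langle X+\xi+r,Y+\eta+\tilde r\rangle=\frac12(\eta(X)+\xi(Y))+\langle r,\tilde r\rangle_{\mathcal G}$. Dorfman bracket: $[X,Y]=\mathcal L_XY+i_Yi_XH+R(X,Y)$, $[X,r]=-2\langle i_XR,r\rangle_{\mathcal G}+\nabla_Xr$,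 $[r_1,r_2]=2\langle\nabla r_1,r_2\rangle_{\mathcal G}+[r_1,r_2]_{\mathcal G}$, $[X,\eta]=\mathcal L_X\eta$, $[\eta_1,\eta_2]=[r,\eta]=0$, together with $[u,v]+[v,u]=2d\langle u,v\rangle$. Unless otherwise stated Courant algebroids are of neutral signature. A generalised almost complex structure is a skew-symmetric $\mathcal J\in\Gamma(\mathrm{End}\,E)$ with $\mathcal J^2=-\mathrm{Id}$; it is integrable if the sections of its $i$-eigenbundle in $E^{\mathbb C}$ are closed under the Dorfman bracket. Its components are defined by $\mathcal JX=JX+CX+\mu X$, $\mathcal J\xi=B\xi-J^*\xi+\nu\xi$, $\mathcal Jr=-\nu^*r-\mu^*r+Ar$ for $X\in TM$, $\xi\in T^*M$, $r\in\mathcal G$ (with $*$ denoting adjoints with respect to the scalar product of $E$). In particular $B=\pi\circ\mathcal J|_{T^*M}:T^*M\to TM$ is skew and is regarded as a bivector by $B(\xi,\eta)=\eta(B\xi)$. *)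

(* Defs.v *)
From HB Require Import structures.
From mathcomp Require Import all_boot all_order all_algebra.
From mathcomp Require Import all_classical all_reals all_analysis.
From mathcomp Require Import ring.
Import Order.TTheory GRing.Theory Num.Theory.
Import numFieldNormedType.Exports.

Set Implicit Arguments.
Unset Strict Implicit.
Unset Printing Implicit Defensive.

Local Open Scope classical_set_scope.
Local Open Scope ring_scope.

Section SmoothEuclidean.
Variables (R : realType) (n : nat).
Implicit Types (W : set 'rV[R]_n) (f g : 'rV[R]_n -> R).

(* On an open set W: all iterated partial derivatives of f up to order k exist
   and are continuous. *)
Fixpoint Ck (k : nat) W f : Prop :=
  (forall x, W x -> {for x, continuous f}) /\
  if k is k'.+1 then
    forall j : 'I_n, (forall x, W x -> derivable f x (delta_mx 0 j)) /\
                     Ck k' W ('D_(delta_mx 0 j) f)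
  else True.

Definition smooth_in W f : Prop := forall k, Ck k W f.

Lemma Ck_eq k W f g : open W -> (forall x, W x -> f x = g x) ->
  Ck k W f -> Ck k W g.
Proof.
move=> oW efg.
have near_fg h1 h2 x : (forall y, W y -> h1 y = h2 y) -> W x ->
    \near x, h1 x = h2 x :> R.
  move=> e Wx; have := open_nbhs_nbhs (conj oW Wx).
  by apply: filterS => y Wy; apply: e.
have eq_cont (h1 h2 : 'rV[R]_n -> R) : (forall y, W y -> h1 y = h2 y) ->
    (forall x, W x -> {for x, continuous h1}) ->
    (forall x, W x -> {for x, continuous h2}).
  move=> e c x Wx; rewrite /prop_for /continuous_at -(e _ Wx).
  exact: cvg_trans (near_eq_cvg (near_fg _ _ _ e Wx)) (c _ Wx).
elim: k f g efg => [|k IH] f g efg [cf Hf]; first by split=> //; exact: eq_cont cf.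
split; first exact: eq_cont cf.
move=> j; have [df Df] := Hf j; split.
  by move=> x Wx; apply: near_eq_derivable (near_fg _ _ _ efg Wx) (df _ Wx).
by apply: IH Df => x Wx; apply: near_eq_derive; exact: near_fg.
Qed.

Lemma CkS k W f : Ck k.+1 W f -> Ck k W f.
Proof.
elim: k f => [|k IH] f [cf Hf]; first by split.
by split => // j; have [df /IH Df] := Hf j.
Qed.

Lemma Ck_cst k W (a : R) : open W -> Ck k W (cst a).
Proof.
move=> oW; elim: k a => [|k IH] a /=; first by split => // x _; exact: cst_continuous.
split; first by move=> x _; exact: cst_continuous.
move=> j; split; first by move=> x _; exact: derivable_cst.
apply: Ck_eq (IH 0) => // x _; by rewrite derive_cst.
Qed.

Lemma Ck_add k W f g : open W -> Ck k W f -> Ck k W g -> Ck k W (f + g).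
Proof.
move=> oW; elim: k f g => [|k IH] f g [cf Hf] [cg Hg].
  by split => // x Wx; apply: continuousD; [exact: cf | exact: cg].
split; first by move=> x Wx; apply: continuousD; [exact: cf | exact: cg].
move=> j; have [df Df] := Hf j; have [dg Dg] := Hg j; split.
  by move=> x Wx; apply: derivableD; [exact: df | exact: dg].
by apply: Ck_eq (IH _ _ Df Dg) => // x Wx; rewrite deriveD //; [exact: df|exact: dg].
Qed.

Lemma Ck_mul k W f g : open W -> Ck k W f -> Ck k W g -> Ck k W (f * g).
Proof.
move=> oW; elim: k f g => [|k IH] f g hf hg.
  by split => // x Wx; apply: continuousM; [exact: hf.1 | exact: hg.1].
have [[cf Hf] [cg Hg]] := (hf, hg).
split; first by move=> x Wx; apply: continuousM; [exact: cf | exact: cg].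
move=> j; have [df Df] := Hf j; have [dg Dg] := Hg j; split.
  by move=> x Wx; apply: derivableM; [exact: df | exact: dg].
apply: Ck_eq (Ck_add oW (IH _ _ (CkS hf) Dg) (IH _ _ (CkS hg) Df)) => // x Wx.
by rewrite deriveM //; [exact: df|exact: dg].
Qed.

Lemma smooth_in_cst W (a : R) : open W -> smooth_in W (cst a).
Proof. by move=> oW k; exact: Ck_cst. Qed.

Lemma smooth_inD W f g : open W ->
  smooth_in W f -> smooth_in W g -> smooth_in W (f + g).
Proof. by move=> oW hf hg k; exact: Ck_add. Qed.

Lemma smooth_inM W f g : open W ->
  smooth_in W f -> smooth_in W g -> smooth_in W (f * g).
Proof. by move=> oW hf hg k; exact: Ck_mul. Qed.

Lemma smooth_inS W1 W2 f : W2 `<=` W1 -> smooth_in W1 f -> smooth_in W2 f.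
Proof.
move=> W21 hf k; elim: k f {hf}(hf k) => [|k IH] f [cf Hf].
  by split=> // x /W21; exact: cf.
split=> [x /W21|j]; first exact: cf.
by have [df Df] := Hf j; split=> [x /W21|]; [exact: df | exact: IH].
Qed.

End SmoothEuclidean.

Record chart (R : realType) (n : nat) (M : topologicalType) := Chart {
  chart_dom : set M;
  chart_map :> M -> 'rV[R]_n;
  chart_inv : 'rV[R]_n -> M;
  chart_dom_open : open chart_dom;
  chart_img_open : open (chart_map @` chart_dom);
  chart_mapK : forall x, chart_dom x -> chart_inv (chart_map x) = x;
  chart_map_continuous :
    forall x, chart_dom x -> {for x, continuous chart_map};
  chart_inv_continuous :
    forall y, (chart_map @` chart_dom) y -> {for y, continuous chart_inv}
}.

Definition chart_compat (R : realType) n (M : topologicalType)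
    (c d : chart R n M) : Prop :=
  forall j, smooth_in (c @` (chart_dom c `&` chart_dom d))
                      (fun y => d (chart_inv c y) 0 j).

(* The atlas need not be maximal: it determines a unique maximal one, with the
   same smooth functions. *)
Record manifold (R : realType) (n : nat) := Manifold {
  manifold_space :> topologicalType;
  atlas : set (chart R n manifold_space);
  atlas_cover : forall x, exists2 c, atlas c & chart_dom c x;
  atlas_compat : forall c d, atlas c -> atlas d -> chart_compat c d;
  manifold_hausdorff : hausdorff_space manifold_space;
  manifold_second_countable : @second_countable manifold_space
}.

Section SmoothFunctions.
Variables (R : realType) (n : nat) (M : manifold R n).
Implicit Types (U : set M) (f g : M -> R).

Definition smooth_on U f : Prop := forall c, atlas c ->
  smooth_in (c @` (chart_dom c `&` U)) (f \o chart_inv c).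

Lemma chart_open (c : chart R n M) U : open U -> open (c @` (chart_dom c `&` U)).
Proof.
move=> oU; rewrite openE => y [x [cx Ux] <-{y}]; rewrite /interior.
have img : (c @` chart_dom c) (c x) by exists x.
have inv_cvg := chart_inv_continuous img.
have nU : nbhs (c x) (chart_inv c @^-1` U).
  by apply: inv_cvg; rewrite chart_mapK //; exact: open_nbhs_nbhs.
have := open_nbhs_nbhs (conj (chart_img_open (c := c)) img).
move=> /(filterI nU); apply: filterS.
move=> z [/= Uz [y cy ez]]; exists y => //; split=> //.
by move: Uz; rewrite -ez chart_mapK.
Qed.

Lemma smooth_on_cst U (a : R) : open U -> smooth_on U (cst a).
Proof. by move=> oU c _; apply: smooth_in_cst; exact: chart_open. Qed.

Lemma smooth_onD U f g : open U ->
  smooth_on U f -> smooth_on U g -> smooth_on U (f + g).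
Proof. by move=> oU hf hg c ac; exact: (smooth_inD (chart_open oU) (hf c ac) (hg c ac)). Qed.

Lemma smooth_onM U f g : open U ->
  smooth_on U f -> smooth_on U g -> smooth_on U (f * g).
Proof. by move=> oU hf hg c ac; exact: (smooth_inM (chart_open oU) (hf c ac) (hg c ac)). Qed.

Lemma smooth_onS U V f : V `<=` U ->
  smooth_on U f -> smooth_on V f.
Proof.
move=> VU hf c ac; apply: smooth_inS (hf c ac) => _ [x [cx Vx] <-].
by exists x => //; split=> //; exact: VU.
Qed.

Definition smooth_fun : {pred M -> R} := fun f => `[< smooth_on setT f >].

Lemma smooth_funP f : reflect (smooth_on setT f) (f \in smooth_fun).
Proof. exact: asboolP. Qed.

Lemma smooth_fun_subring : subring_closed smooth_fun.
Proof.
have cstP (a : R) : smooth_on setT (cst a) by apply: smooth_on_cst; exact: openT.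
split=> [|f g /smooth_funP hf /smooth_funP hg|f g /smooth_funP hf /smooth_funP hg];
  apply/smooth_funP.
- exact: cstP.
- apply: smooth_onD => //; first exact: openT.
  have -> : - g = cst (-1) * g by apply/funext => x; rewrite mulrfctE mulN1r.
  by apply: smooth_onM => //; exact: openT.
- by apply: smooth_onM => //; exact: openT.
Qed.

Lemma smooth_fun_submod : submod_closed smooth_fun.
Proof.
have [h1 hB hM] := smooth_fun_subring.
have h0 : 0 \in smooth_fun by rewrite -(subrr 1); exact: hB.
split=> // a f g hf hg.
rewrite -(opprK g); apply: (hB); last by rewrite -sub0r; exact: hB.
have -> : a *: f = cst a * f by [].
by apply: hM => //; apply/smooth_funP/smooth_on_cst; exact: openT.
Qed.

HB.instance Definition _ :=
  GRing.isSubringClosed.Build (M -> R) smooth_fun smooth_fun_subring.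
HB.instance Definition _ :=
  GRing.isSubmodClosed.Build R (M -> R) smooth_fun smooth_fun_submod.

Record Cinfty := MkCinfty { Cinfty_fun :> M -> R; _ : Cinfty_fun \in smooth_fun }.
HB.instance Definition _ := [isSub for Cinfty_fun].
HB.instance Definition _ := [Choice of Cinfty by <:].
HB.instance Definition _ := GRing.SubChoice_isSubComPzRing.Build
  (M -> R) smooth_fun Cinfty smooth_fun_subring.
HB.instance Definition _ := [SubZmodule_isSubLmodule of Cinfty by <:].

Definition mk_smooth f (hf : smooth_on setT f) : Cinfty :=
  MkCinfty (introT (smooth_funP f) hf).

Lemma smoothP (f : Cinfty) : smooth_on setT f.
Proof. exact/smooth_funP/(valP f). Qed.

Lemma Cinfty_ext (f g : Cinfty) : (forall p, f p = g p) -> f = g.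
Proof. by move=> fg; apply/val_inj/funext. Qed.

End SmoothFunctions.


(* The pointwise vector space of all (not necessarily smooth) sections of a
   family of vector spaces. *)
Section Sections.
Variables (R : realType) (B : Type) (V : B -> lmodType R).

Definition sections : Type := forall p, V p.
HB.instance Definition _ := gen_eqMixin sections.
HB.instance Definition _ := gen_choiceMixin sections.

Implicit Types s t u : sections.
Let add s t : sections := fun p => s p + t p.
Let opp s : sections := fun p => - s p.
Let scale (a : R) s : sections := fun p => a *: s p.

Fact sections_addA : associative add.
Proof. by move=> s t u; apply: functional_extensionality_dep => p; exact: addrA. Qed.
Fact sections_addC : commutative add.
Proof. by move=> s t; apply: functional_extensionality_dep => p; exact: addrC. Qed.
Fact sections_add0 : left_id (fun p => 0 : V p) add.
Proof. by move=> s; apply: functional_extensionality_dep => p; exact: add0r. Qed.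
Fact sections_addN : left_inverse (fun p => 0 : V p) opp add.
Proof. by move=> s; apply: functional_extensionality_dep => p; exact: addNr. Qed.
HB.instance Definition _ := GRing.isZmodule.Build sections
  sections_addA sections_addC sections_add0 sections_addN.

Fact sections_scaleA a b s : scale a (scale b s) = scale (a * b) s.
Proof. by apply: functional_extensionality_dep => p; exact: scalerA. Qed.
Fact sections_scale1 : left_id 1 scale.
Proof. by move=> s; apply: functional_extensionality_dep => p; exact: scale1r. Qed.
Fact sections_scaleDr : right_distributive scale +%R.
Proof. by move=> a s t; apply: functional_extensionality_dep => p; exact: scalerDr. Qed.
Fact sections_scaleDl s : {morph scale^~ s : a b / a + b}.
Proof. by move=> a b; apply: functional_extensionality_dep => p; exact: scalerDl. Qed.
HB.instance Definition _ := GRing.Zmodule_isLmodule.Build R sections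
  sections_scaleA sections_scale1 sections_scaleDr sections_scaleDl.

End Sections.

Section TangentBundle.
Variables (R : realType) (n : nat) (M : manifold R n).
Implicit Types (p : M) (f g : Cinfty M).

(* A tangent vector at p is a derivation of C^oo(M) at p. *)
Definition derivation_at p (D : Cinfty M -> R) : Prop :=
  scalar D /\ (forall f g, D (f * g) = f p * D g + g p * D f).

Definition derivation_pred p : {pred Cinfty M -> R} :=
  fun D => `[< derivation_at p D >].

Fact derivation_submod p : submod_closed (derivation_pred p).
Proof.
split.
  apply/asboolP; split=> [a f g|f g]; first by rewrite /= mulr0 addr0.
  by rewrite /= !mulr0 addr0.
move=> a D1 D2 /asboolP[lin1 leib1] /asboolP[lin2 leib2]; apply/asboolP.
split=> [b f g|f g]; rewrite !addrfctE !scalrfctE.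
  by rewrite lin1 lin2 /GRing.scale /=; ring.
by rewrite leib1 leib2 /GRing.scale /=; ring.
Qed.
HB.instance Definition _ p := GRing.isSubmodClosed.Build R (Cinfty M -> R)
  (derivation_pred p) (derivation_submod p).

Record tangent p := MkTangent {
  tangent_fun :> Cinfty M -> R; _ : tangent_fun \in derivation_pred p }.
HB.instance Definition _ p := [isSub for @tangent_fun p].
HB.instance Definition _ p := [Choice of tangent p by <:].
HB.instance Definition _ p := [SubChoice_isSubLmodule of tangent p by <:].

Definition covector_pred p : {pred tangent p -> R} := fun xi => `[< scalar xi >].
Arguments covector_pred p _ : clear implicits.

Fact covector_submod p : submod_closed (covector_pred p).
Proof.
split; first by apply/asboolP => a u v; rewrite /= mulr0 addr0.
move=> a x1 x2 /asboolP lin1 /asboolP lin2; apply/asboolP => b u v.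
by rewrite !addrfctE !scalrfctE lin1 lin2 /GRing.scale /=; ring.
Qed.
HB.instance Definition _ p := GRing.isSubmodClosed.Build R (tangent p -> R)
  (covector_pred p) (covector_submod p).

Record cotangent p := MkCotangent {
  cotangent_fun :> tangent p -> R; _ : cotangent_fun \in covector_pred p }.
HB.instance Definition _ p := [isSub for @cotangent_fun p].
HB.instance Definition _ p := [Choice of cotangent p by <:].
HB.instance Definition _ p := [SubChoice_isSubLmodule of cotangent p by <:].

Lemma tangentP p (v : tangent p) : derivation_at p v.
Proof. exact/asboolP/(valP v). Qed.

Lemma cotangentP p (xi : cotangent p) : scalar xi.
Proof. exact/asboolP/(valP xi). Qed.

(* Smooth vector fields (1-forms) are those sending smooth functions (vector
   fields) to smooth functions. *)
Definition vfield_pred : {pred sections tangent} :=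
  fun X => `[< forall f, smooth_on setT (fun p => X p f) >].

Fact vfield_submod : submod_closed vfield_pred.
Proof.
split.
  apply/asboolP => f; apply: (@smooth_on_cst _ _ M setT 0); exact: openT.
move=> a X Y /asboolP hX /asboolP hY; apply/asboolP => f.
exact: (smoothP (a *: mk_smooth (hX f) + mk_smooth (hY f))).
Qed.
HB.instance Definition _ := GRing.isSubmodClosed.Build R (sections tangent)
  vfield_pred vfield_submod.

Record vfield := MkVfield {
  vfield_section : sections tangent; _ : vfield_section \in vfield_pred }.
HB.instance Definition _ := [isSub for vfield_section].
HB.instance Definition _ := [Choice of vfield by <:].
HB.instance Definition _ := [SubChoice_isSubLmodule of vfield by <:].

Definition vfield_at (X : vfield) : forall p, tangent p := vfield_section X.
Coercion vfield_at : vfield >-> Funclass.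
Implicit Types X Y Z : vfield.

Lemma vfieldP X f : smooth_on setT (fun p => X p f).
Proof. by have /asboolP := valP X; apply. Qed.

Definition vf_act X f : Cinfty M := mk_smooth (vfieldP X f).

Definition lie_bracket_at X Y p : Cinfty M -> R :=
  fun f => X p (vf_act Y f) - Y p (vf_act X f).

Fact lie_bracket_derivation X Y p : derivation_at p (lie_bracket_at X Y p).
Proof.
have actZ V a f g : vf_act V (a *: f + g) = a *: vf_act V f + vf_act V g.
  by apply: Cinfty_ext => q; have [lin _] := tangentP (V q); exact: lin.
have actM V f g : vf_act V (f * g) = f * vf_act V g + g * vf_act V f.
  by apply: Cinfty_ext => q; have [_ leib] := tangentP (V q); exact: leib.
have addT q (v : tangent q) f g : v (f + g) = v f + v g.
  by have [lin _] := tangentP v; rewrite -[f]scale1r lin scale1r mul1r.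
split=> [a f g|f g]; rewrite /lie_bracket_at ?actZ ?actM.
  have [linX _] := tangentP (X p); have [linY _] := tangentP (Y p).
  by rewrite linX linY; ring.
have [_ leibX] := tangentP (X p); have [_ leibY] := tangentP (Y p).
by rewrite !addT !leibX !leibY /=; ring.
Qed.

Fact lie_bracket_smooth X Y :
  ((fun p => MkTangent (introT (asboolP _) (lie_bracket_derivation X Y p)))
     : sections tangent) \in vfield_pred.
Proof.
apply/asboolP => f.
exact: (smoothP (vf_act X (vf_act Y f) - vf_act Y (vf_act X f))).
Qed.

Definition lie_bracket X Y : vfield := MkVfield (lie_bracket_smooth X Y).

Definition oneform_pred : {pred sections cotangent} :=
  fun xi => `[< forall X, smooth_on setT (fun p => xi p (X p)) >].

Fact oneform_submod : submod_closed oneform_pred.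
Proof.
split.
  apply/asboolP => X; apply: (@smooth_on_cst _ _ M setT 0); exact: openT.
move=> a xi eta /asboolP hxi /asboolP heta; apply/asboolP => X.
exact: (smoothP (a *: mk_smooth (hxi X) + mk_smooth (heta X))).
Qed.
HB.instance Definition _ := GRing.isSubmodClosed.Build R (sections cotangent)
  oneform_pred oneform_submod.

Record oneform := MkOneform {
  oneform_section : sections cotangent; _ : oneform_section \in oneform_pred }.
HB.instance Definition _ := [isSub for oneform_section].
HB.instance Definition _ := [Choice of oneform by <:].
HB.instance Definition _ := [SubChoice_isSubLmodule of oneform by <:].

Definition oneform_at (xi : oneform) : forall p, cotangent p :=
  oneform_section xi.
Coercion oneform_at : oneform >-> Funclass.

Lemma oneformP (xi : oneform) X : smooth_on setT (fun p => xi p (X p)).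
Proof. by have /asboolP := valP xi; apply. Qed.

Definition pairing (xi : oneform) X : Cinfty M := mk_smooth (oneformP xi X).

Fact mk_oneform_subproof (xi : forall p, tangent p -> R)
    (lin : forall p, scalar (xi p))
    (sm : forall X, smooth_on setT (fun p => xi p (X p))) :
  ((fun p => MkCotangent (introT (asboolP _) (lin p))) : sections cotangent)
    \in oneform_pred.
Proof. exact/asboolP. Qed.

Definition mk_oneform (xi : forall p, tangent p -> R)
    (lin : forall p, scalar (xi p))
    (sm : forall X, smooth_on setT (fun p => xi p (X p))) : oneform :=
  MkOneform (mk_oneform_subproof lin sm).

Definition diff_fun f : oneform := @mk_oneform (fun p v => v f)
  (fun p a v w => erefl) (fun X => vfieldP X f).

(* L_X eta is the 1-form determined by (L_X eta)(Y) = X(eta(Y)) - eta([X,Y]).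
   The right-hand side is C^oo(M)-linear in Y, and every tangent vector extends
   to a vector field, so that there is exactly one such form. *)
Definition lie_derivative X (eta : oneform) : oneform :=
  xget 0 [set zeta : oneform | forall Y,
    pairing zeta Y =
      vf_act X (pairing eta Y) - pairing eta (lie_bracket X Y)].

End TangentBundle.

Section VectorBundles.
Variables (R : realType) (n : nat) (M : manifold R n).

Record local_triv (V : M -> lmodType R) (k : nat) := LocalTriv {
  triv_dom : set M;
  triv_map :> forall p, {linear V p -> 'rV[R]_k};
  triv_open : open triv_dom;
  triv_bij : forall p, triv_dom p -> bijective (triv_map p)
}.

Record vector_bundle (k : nat) := VectorBundle {
  fibre :> M -> lmodType R;
  trivs : set (local_triv fibre k);
  trivs_cover : forall p, exists2 t, trivs t & triv_dom t p;
  trivs_compat : forall s t, trivs s -> trivs t -> exists g : M -> 'M[R]_k,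
    (forall p, triv_dom s p -> triv_dom t p ->
       forall x, t p x = s p x *m g p) /\
    (forall i j, smooth_on (triv_dom s `&` triv_dom t) (fun p => g p i j))
}.

Variables (k : nat) (V : vector_bundle k).

Definition gsection_pred : {pred sections V} := fun r =>
  `[< forall t, trivs t -> forall j,
      smooth_on (triv_dom t) (fun p => t p (r p) 0 j) >].

Fact gsection_submod : submod_closed gsection_pred.
Proof.
split.
  apply/asboolP => t _ j.
  have -> : (fun p => t p (0 : V p) 0 j) = cst 0.
    by apply/funext => p; rewrite linear0 mxE.
  by apply: smooth_on_cst; exact: triv_open.
move=> a r s /asboolP hr /asboolP hs; apply/asboolP => t ht j.
have -> : (fun p => t p ((a *: r + s) p) 0 j) =
    cst a * (fun p => t p (r p) 0 j) + (fun p => t p (s p) 0 j).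
  by apply/funext => p; rewrite linearP !mxE.
have ot := triv_open t.
apply: smooth_onD => //; last exact: hs.
by apply: smooth_onM => //; [exact: smooth_on_cst | exact: hr].
Qed.
HB.instance Definition _ := GRing.isSubmodClosed.Build R (sections V)
  gsection_pred gsection_submod.

Record gsection := MkGsection {
  gsection_section : sections V; _ : gsection_section \in gsection_pred }.
HB.instance Definition _ := [isSub for gsection_section].
HB.instance Definition _ := [Choice of gsection by <:].
HB.instance Definition _ := [SubChoice_isSubLmodule of gsection by <:].

Definition gsection_at (r : gsection) : forall p, V p := gsection_section r.
Coercion gsection_at : gsection >-> Funclass.

Fact scale_section_subproof (f : Cinfty M) (r : gsection) :
  ((fun p => f p *: r p) : sections V) \in gsection_pred.
Proof.
apply/asboolP => t ht j; have ot := triv_open t.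
have -> : (fun p => t p (f p *: r p) 0 j) =
    (f : M -> R) * (fun p => t p (r p) 0 j).
  by apply/funext => p; rewrite linearZ mxE.
apply: smooth_onM => //.
  by apply: smooth_onS (smoothP f).
by have /asboolP := valP r; apply.
Qed.

Definition scale_section f r : gsection := MkGsection (scale_section_subproof f r).

Record connection := Connection {
  nabla_at :> forall p, tangent p -> gsection -> V p;
  nabla_at_linear : forall p r, linear ((@nabla_at p)^~ r);
  nabla_linear : forall p (v : tangent p), linear (nabla_at v);
  nabla_leibniz : forall p (v : tangent p) f r,
    nabla_at v (scale_section f r) = v f *: r p + f p *: nabla_at v r;
  nabla_smooth : forall (X : vfield M) r,
    ((fun p => nabla_at (X p) r) : sections V) \in gsection_pred
}.

Definition nabla (D : connection) (X : vfield M) (r : gsection) : gsection :=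
  MkGsection (nabla_smooth D X r).

Record twoform := Twoform {
  twoform_at :> forall p, tangent p -> tangent p -> V p;
  twoform_linearl : forall p (w : tangent p), linear ((@twoform_at p)^~ w);
  twoform_linearr : forall p (v : tangent p), linear (twoform_at v);
  twoform_alt : forall p (v : tangent p), twoform_at v v = 0;
  twoform_smooth : forall X Y : vfield M,
    ((fun p => twoform_at (X p) (Y p)) : sections V) \in gsection_pred
}.
End VectorBundles.

Section QuadraticLieAlgebraBundles.
Variables (R : realType) (n : nat) (M : manifold R n) (k : nat).

Record quadratic_bundle := QuadraticBundle {
  qbundle :> vector_bundle M k;
  gbr : forall p, qbundle p -> qbundle p -> qbundle p;
  gform : forall p, qbundle p -> qbundle p -> R;
  gbr_linearl : forall p (y : qbundle p), linear ((@gbr p)^~ y);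
  gbr_linearr : forall p (x : qbundle p), linear (gbr x);
  gbr_alt : forall p (x : qbundle p), gbr x x = 0;
  gbr_jacobi : forall p (x y z : qbundle p),
    gbr x (gbr y z) + gbr y (gbr z x) + gbr z (gbr x y) = 0;
  gform_linear : forall p (x : qbundle p), scalar (gform x);
  gform_sym : forall p (x y : qbundle p), gform x y = gform y x;
  gform_nondeg : forall p (x : qbundle p), (forall y, gform x y = 0) -> x = 0;
  gform_ad : forall p (x y z : qbundle p),
    gform (gbr x y) z + gform y (gbr x z) = 0;
  gbr_smooth : forall r s : gsection qbundle,
    ((fun p => gbr (r p) (s p)) : sections qbundle)
      \in @gsection_pred _ _ _ _ qbundle;
  gform_smooth : forall r s : gsection qbundle,
    smooth_on setT (fun p => gform (r p) (s p))
}.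

Variable G : quadratic_bundle.
Implicit Types (r s : gsection G) (X Y Z W : vfield M) (D : connection G).

Definition gbracket r s : gsection G := MkGsection (gbr_smooth r s).
Definition gpairing r s : Cinfty M := mk_smooth (gform_smooth r s).

Lemma gform_linearl p (y : G p) : scalar ((@gform G p)^~ y).
Proof. by move=> a u v; rewrite /= ![gform _ y]gform_sym gform_linear. Qed.

Record threeform := Threeform {
  threeform_at :> forall p : M, tangent p -> tangent p -> tangent p -> R;
  threeform_linear1 : forall p (v w : tangent p),
    scalar (fun u => threeform_at u v w);
  threeform_linear2 : forall p (u w : tangent p),
    scalar (fun v => threeform_at u v w);
  threeform_linear3 : forall p (u v : tangent p), scalar (threeform_at u v);
  threeform_alt12 : forall p (u v : tangent p), threeform_at u u v = 0;
  threeform_alt23 : forall p (u v : tangent p), threeform_at u v v = 0;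
  threeform_smooth : forall X Y Z : vfield M,
    smooth_on setT (fun p => threeform_at (X p) (Y p) (Z p))
}.

Definition twoform_val (F : twoform G) X Y : gsection G :=
  MkGsection (twoform_smooth F X Y).
Definition threeform_val (H : threeform) X Y Z : Cinfty M :=
  mk_smooth (threeform_smooth H X Y Z).

Definition curvature D X Y r : gsection G :=
  nabla D X (nabla D Y r) - nabla D Y (nabla D X r)
    - nabla D (lie_bracket X Y) r.

Definition ext_cov_deriv D (F : twoform G) X Y Z : gsection G :=
  nabla D X (twoform_val F Y Z) - nabla D Y (twoform_val F X Z)
    + nabla D Z (twoform_val F X Y)
    - twoform_val F (lie_bracket X Y) Z + twoform_val F (lie_bracket X Z) Y
    - twoform_val F (lie_bracket Y Z) X.

Definition ext_deriv3 (H : threeform) X Y Z W : Cinfty M :=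
  vf_act X (threeform_val H Y Z W) - vf_act Y (threeform_val H X Z W)
    + vf_act Z (threeform_val H X Y W) - vf_act W (threeform_val H X Y Z)
    - threeform_val H (lie_bracket X Y) Z W
    + threeform_val H (lie_bracket X Z) Y W
    - threeform_val H (lie_bracket X W) Y Z
    - threeform_val H (lie_bracket Y Z) X W
    + threeform_val H (lie_bracket Y W) X Z
    - threeform_val H (lie_bracket Z W) X Y.

Definition wedge_gform (F : twoform G) X Y Z W : Cinfty M :=
  (gpairing (twoform_val F X Y) (twoform_val F Z W)
   + gpairing (twoform_val F Y Z) (twoform_val F X W)
   + gpairing (twoform_val F Z X) (twoform_val F Y W)) *+ 2.

Record standard_courant := StandardCourant {
  sc_nabla : connection G;
  sc_R : twoform G;
  sc_H : threeform;
  sc_nabla_br : forall X r s, nabla sc_nabla X (gbracket r s) =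
    gbracket (nabla sc_nabla X r) s + gbracket r (nabla sc_nabla X s);
  sc_nabla_form : forall X r s, vf_act X (gpairing r s) =
    gpairing (nabla sc_nabla X r) s + gpairing r (nabla sc_nabla X s);
  sc_curvature : forall X Y r,
    curvature sc_nabla X Y r = gbracket (twoform_val sc_R X Y) r;
  sc_dR : forall X Y Z, ext_cov_deriv sc_nabla sc_R X Y Z = 0;
  sc_dH : forall X Y Z W, ext_deriv3 sc_H X Y Z W = wedge_gform sc_R X Y Z W
}.

(* i_Y i_X H *)
Definition contract2 (H : threeform) X Y : oneform M :=
  @mk_oneform _ _ M (fun p v => H p (X p) (Y p) v)
    (fun p => threeform_linear3 H (X p) (Y p))
    (fun Z => threeform_smooth H X Y Z).

Fact contract_twoform_linear (F : twoform G) X r p :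
  scalar (fun v : tangent p => gform (F p (X p) v) (r p)).
Proof. by move=> a v w; rewrite twoform_linearr gform_linearl. Qed.

(* < i_X F, r > *)
Definition contract_twoform (F : twoform G) X r : oneform M :=
  @mk_oneform _ _ M (fun p v => gform (F p (X p) v) (r p))
    (@contract_twoform_linear F X r)
    (fun Y => gform_smooth (twoform_val F X Y) r).

Fact nabla_form_linear D r s p :
  scalar (fun v : tangent p => gform (D p v r) (s p)).
Proof. by move=> a v w; rewrite nabla_at_linear gform_linearl. Qed.

(* < nabla r, s > *)
Definition nabla_form D r s : oneform M :=
  @mk_oneform _ _ M (fun p v => gform (D p v r) (s p))
    (@nabla_form_linear D r s)
    (fun X => gform_smooth (nabla D X r) s).

(* The fibre of E at p, and the smooth sections of E; an element
   ((X, xi), r) stands for X + xi + r. *)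
Definition Efibre (p : M) : lmodType R := (tangent p * cotangent p * G p)%type.
Definition Esection : lmodType R := (vfield M * oneform M * gsection G)%type.

Definition Eval (u : Esection) (p : M) : Efibre p := (u.1.1 p, u.1.2 p, u.2 p).

Definition Eform (p : M) (x y : Efibre p) : R :=
  2^-1 * (y.1.2 x.1.1 + x.1.2 y.1.1) + gform x.2 y.2.

(* The Dorfman bracket of X + xi + r and Y + eta + s.  The brackets [xi, Y],
   [r, Y] and [xi, s] are those forced by [u, v] + [v, u] = 2 d<u, v>, namely
   [xi, Y] = - L_Y xi + d(xi(Y)), [r, Y] = - [Y, r] and [xi, s] = 0. *)
Definition dorfman (E : standard_courant) (u v : Esection) : Esection :=
  let: (X, xi, r) := u in let: (Y, eta, s) := v in
  let D := sc_nabla E in let F := sc_R E in let H := sc_H E in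
  (lie_bracket X Y,
   contract2 H X Y
   + lie_derivative X eta
   + (- lie_derivative Y xi + diff_fun (pairing xi Y))
   - contract_twoform F X s *+ 2
   + contract_twoform F Y r *+ 2
   + nabla_form D r s *+ 2,
   twoform_val F X Y + nabla D X s - nabla D Y r + gbracket r s).

Definition neutral_form (V : lmodType R) (b : V -> V -> R) : Prop :=
  exists m (e f : 'I_m -> V),
  [/\ forall i j, b (e i) (e j) = (i == j)%:R,
      forall i j, b (f i) (f j) = - (i == j)%:R,
      forall i j, b (e i) (f j) = 0 &
      forall x, exists s t : 'I_m -> R,
        x = \sum_i s i *: e i + \sum_i t i *: f i].

Definition neutral_signature : Prop := forall p, neutral_form (@Eform p).

Record Eendo := MkEendo {
  Eendo_at :> forall p, {linear Efibre p -> Efibre p};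
  Eendo_smooth : forall u : Esection, exists v : Esection,
    forall p, Eval v p = Eendo_at p (Eval u p)
}.

Definition gen_almost_complex (J : Eendo) : Prop :=
  (forall p (x y : Efibre p), Eform (J p x) y + Eform x (J p y) = 0) /\
  (forall p (x : Efibre p), J p (J p x) = - x).

(* The pair (a, b) stands for the section a + i b of the complexification of
   E; it lies in the i-eigenbundle of J when J a + i J b = i (a + i b). *)
Definition in_eigenbundle (J : Eendo) (w : Esection * Esection) : Prop :=
  forall p, (J p (Eval w.1 p), J p (Eval w.2 p)) =
            (- Eval w.2 p, Eval w.1 p).

Definition dorfmanC (E : standard_courant) (w z : Esection * Esection) :
    Esection * Esection :=
  (dorfman E w.1 z.1 - dorfman E w.2 z.2,
   dorfman E w.1 z.2 + dorfman E w.2 z.1).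

Definition gac_integrable (E : standard_courant) (J : Eendo) : Prop :=
  forall w z, in_eigenbundle J w -> in_eigenbundle J z ->
    in_eigenbundle J (dorfmanC E w z).

(* The component B of J : the restriction to T*M followed by the anchor. *)
Definition B_component (J : Eendo) (p : M) (xi : cotangent p) : tangent p :=
  (J p (0, xi, 0)).1.1.

End QuadraticLieAlgebraBundles.

Section Poisson.
Variables (R : realType) (n : nat) (M : manifold R n).

Record bivector_field := BivectorField {
  bivector_at :> forall p : M, cotangent p -> cotangent p -> R;
  bivector_linearl : forall p (eta : cotangent p),
    scalar ((@bivector_at p)^~ eta);
  bivector_linearr : forall p (xi : cotangent p), scalar (bivector_at xi);
  bivector_alt : forall p (xi : cotangent p), bivector_at xi xi = 0;
  bivector_smooth : forall xi eta : oneform M,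
    smooth_on setT (fun p => bivector_at (xi p) (eta p))
}.

Definition poisson_bracket (P : bivector_field) (f g : Cinfty M) : Cinfty M :=
  mk_smooth (bivector_smooth P (diff_fun f) (diff_fun g)).

(* Bilinearity, skew-symmetry and the Leibniz rule of the bracket hold for
   every bivector field. *)
Definition is_poisson (P : bivector_field) : Prop := forall f g h,
  poisson_bracket P f (poisson_bracket P g h)
  + poisson_bracket P g (poisson_bracket P h f)
  + poisson_bracket P h (poisson_bracket P f g) = 0.

End Poisson.

(* Main.v *)
Require Import Defs.
From mathcomp Require Import all_boot all_order all_algebra.
From mathcomp Require Import all_classical all_reals all_analysis.
Import GRing.Theory Num.Theory.

Set Implicit Arguments.
Unset Strict Implicit.
Unset Printing Implicit Defensive.

Local Open Scope ring_scope.

(** Write X_f = B(df), so that the bracket defined by the bivector B is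
    {f, g} = dg(B(df)) = X_f(g). The Jacobi identity for this bracket amounts to
    [X_f, X_g](h) = - X_h{f, g}, and this is what integrability gives.

    Indeed J(df) + i df is a section of the i-eigenbundle for every function f.
    In the complexified Dorfman bracket of the sections given by f and g,
    - the real part is [J df, J dg] - [df, dg], whose anchor is [X_f, X_g];
    - the imaginary part is [J df, dg] + [df, J dg], which is the 1-form
      d(X_f(g)) = d{f, g}: the terms with the connection, R, H or the fibre
      bracket all have a vanishing entry, [J df, dg] = L_{X_f}(dg), and
      [df, J dg] = - L_{X_g}(df) + d(df(X_g)) = 0 (lemmas
      dorfman_diffE_r and dorfman_diffE_l).
    As the bracket is again in the eigenbundle, J maps its imaginary part to its
    real part, so that [X_f, X_g] = B(d{f, g}) = X_{f, g}. Evaluating on h and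
    using the skewness of B gives the identity above (lemma
    hamiltonian_bracket).

    The 1-forms in this argument are only evaluated on the vector fields X_h,
    where Lie derivatives of forms are given by Cartan's formula. This is why
    the lemmas describe brackets and Lie derivatives by their values on vector
    fields, not as equal forms. *)

Lemma linear_for0 (R : pzRingType) (U : lmodType R) (V : zmodType)
    (s : GRing.Scale.law R V) (phi : U -> V) :
  linear_for s phi -> phi 0 = 0.
Proof.
move=> lin; have := lin (-1) 0 0.
by rewrite scaler0 addr0 GRing.Scale.N1op addNr.
Qed.

(** * Lie derivatives on vector fields *)

Section Calculus.
Variables (R : realType) (n : nat) (M : manifold R n).
Implicit Types (p : M) (f : Cinfty M) (X Y Z : vfield M).

Lemma tangent0 p (v : tangent p) : v 0 = 0.
Proof. by have [lin _] := tangentP v; exact: linear_for0 lin. Qed.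

Lemma cotangent0 p (xi : cotangent p) : xi 0 = 0.
Proof. exact: linear_for0 (cotangentP xi). Qed.

Lemma vf_act0 f : vf_act (0 : vfield M) f = 0.
Proof. exact: Cinfty_ext. Qed.

Lemma vf_actN X f : vf_act X (- f) = - vf_act X f.
Proof.
apply: Cinfty_ext => p; have [lin _] := tangentP (X p).
have := lin (-1) f 0; rewrite scaleN1r addr0 => /= ->.
by rewrite tangent0 addr0 mulN1r.
Qed.

Lemma vf_act_lie_bracket X Y f :
  vf_act (lie_bracket X Y) f = vf_act X (vf_act Y f) - vf_act Y (vf_act X f).
Proof. exact: Cinfty_ext. Qed.

Lemma lie_bracket0r X p : lie_bracket X 0 p = 0.
Proof.
by apply/val_inj/funext => f; rewrite /= /lie_bracket_at vf_act0 tangent0 subrr.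
Qed.

Lemma lie_bracket0l X p : lie_bracket 0 X p = 0.
Proof.
by apply/val_inj/funext => f; rewrite /= /lie_bracket_at vf_act0 tangent0 subrr.
Qed.

(** Cartan's formula prescribes all values on vector fields, so any solution
    agrees there with the chosen one. *)
Lemma lie_derivative_pairing X (eta zeta : oneform M) :
  (forall Y, pairing zeta Y =
     vf_act X (pairing eta Y) - pairing eta (lie_bracket X Y)) ->
  forall Z p, lie_derivative X eta p (Z p) = zeta p (Z p).
Proof.
move=> hzeta Z p; rewrite /lie_derivative.
case: xgetP => [xi _ /= hL|/(_ zeta)//].
by have /(congr1 (fun f : Cinfty M => f p)) := etrans (hL Z) (esym (hzeta Z)).
Qed.

(** The Lie derivative commutes with d: on Y, both sides are
    X(Y f) - [X, Y] f = Y(X f). *)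
Lemma lie_derivative_diff X f Z p :
  lie_derivative X (diff_fun f) p (Z p) = Z p (vf_act X f).
Proof.
have -> // := @lie_derivative_pairing X (diff_fun f) (diff_fun (vf_act X f)).
move=> Y; apply: Cinfty_ext => q; apply/esym.
have e : vf_act Y f = pairing (diff_fun f) Y by exact: Cinfty_ext.
by rewrite -e /= /lie_bracket_at subKr.
Qed.

Lemma lie_derivative0 (eta : oneform M) Z p :
  lie_derivative 0 eta p (Z p) = 0.
Proof.
have -> // := @lie_derivative_pairing 0 eta 0.
move=> Y; apply: Cinfty_ext => q.
change (0 = 0 - eta q (lie_bracket 0 Y q)).
by rewrite lie_bracket0l cotangent0 subr0.
Qed.

End Calculus.

(** * Dorfman brackets with exact forms *)

Section DorfmanDiff.
Variables (R : realType) (n k : nat) (M : manifold R n).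
Variables (G : quadratic_bundle M k) (E : standard_courant G).
Implicit Types (p : M) (f : Cinfty M) (Z : vfield M) (v : Esection G).

Definition diffE f : Esection G := (0, diff_fun f, 0).

Lemma gform0r p (x : G p) : gform x 0 = 0.
Proof. exact: linear_for0 (gform_linear x). Qed.

Lemma gform0l p (x : G p) : gform 0 x = 0.
Proof. by rewrite gform_sym gform0r. Qed.

(** With X the anchor of v, the only surviving term of [v, df] is
    L_X(df) = d(X f). *)
Lemma dorfman_diffE_r v f p :
  [/\ (dorfman E v (diffE f)).1.1 p = 0, (dorfman E v (diffE f)).2 p = 0 &
      forall Z, (dorfman E v (diffE f)).1.2 p (Z p) = Z p (vf_act v.1.1 f)].
Proof.
case: v => [[X xi] r] /=; split; first exact: lie_bracket0r.
- change (sc_R E p (X p) 0 + sc_nabla E p (X p) 0 - sc_nabla E p 0 r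
    + gbr (r p) 0 = 0).
  rewrite (linear_for0 (twoform_linearr _ _)) (linear_for0 (nabla_linear _ _)).
  rewrite (linear_for0 (nabla_at_linear _ _)) (linear_for0 (gbr_linearr _)).
  by rewrite !addr0 subr0.
- move=> Z.
  change (sc_H E p (X p) 0 (Z p) + lie_derivative X (diff_fun f) p (Z p)
    + (- lie_derivative 0 xi p (Z p) + Z p (pairing xi 0))
    - gform (sc_R E p (X p) (Z p)) 0 *+ 2
    + gform (sc_R E p 0 (Z p)) (r p) *+ 2
    + gform (sc_nabla E p (Z p) r) 0 *+ 2 = Z p (vf_act X f)).
  rewrite lie_derivative_diff lie_derivative0 !gform0r.
  rewrite (linear_for0 (threeform_linear2 _ _ _)).
  rewrite (linear_for0 (twoform_linearl _ _)) gform0l.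
  have -> : pairing xi 0 = 0 by apply: Cinfty_ext => q; exact: cotangent0.
  by rewrite tangent0 mul0rn oppr0 !addr0 add0r.
Qed.

(** With X the anchor of v, the surviving terms - L_X(df) and d(df(X)) of
    [df, v] cancel. *)
Lemma dorfman_diffE_l v f p :
  [/\ (dorfman E (diffE f) v).1.1 p = 0, (dorfman E (diffE f) v).2 p = 0 &
      forall Z, (dorfman E (diffE f) v).1.2 p (Z p) = 0].
Proof.
case: v => [[X xi] r] /=; split; first exact: lie_bracket0l.
- change (sc_R E p 0 (X p) + sc_nabla E p 0 r - sc_nabla E p (X p) 0
    + gbr 0 (r p) = 0).
  rewrite (linear_for0 (twoform_linearl _ _)) (linear_for0 (nabla_linear _ _)).
  rewrite (linear_for0 (nabla_at_linear _ _)) (linear_for0 (gbr_linearl _)).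
  by rewrite !addr0 subr0.
- move=> Z.
  change (sc_H E p 0 (X p) (Z p) + lie_derivative 0 xi p (Z p)
    + (- lie_derivative X (diff_fun f) p (Z p) + Z p (pairing (diff_fun f) X))
    - gform (sc_R E p 0 (Z p)) (r p) *+ 2
    + gform (sc_R E p (X p) (Z p)) 0 *+ 2
    + gform (sc_nabla E p (Z p) 0) (r p) *+ 2 = 0).
  rewrite lie_derivative_diff lie_derivative0 gform0r.
  rewrite (linear_for0 (threeform_linear1 _ _ _)).
  rewrite (linear_for0 (nabla_linear _ _)).
  rewrite (linear_for0 (twoform_linearl _ _)) !gform0l.
  have -> : pairing (diff_fun f) X = vf_act X f by exact: Cinfty_ext.
  by rewrite addNr mul0rn oppr0 !addr0.
Qed.

End DorfmanDiff.

(** * The bivector and its Poisson bracket *)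

Section BComponent.
Variables (R : realType) (n k : nat) (M : manifold R n).
Variables (G : quadratic_bundle M k) (J : Eendo G).
Hypothesis Jgac : gen_almost_complex J.
Implicit Types (p : M) (f g h : Cinfty M) (u v w : Esection G).

Lemma Eform_sym p (x y : Efibre G p) : Eform x y = Eform y x.
Proof. by rewrite /Eform [X in 2^-1 * X]addrC gform_sym. Qed.

Lemma Eform_cotangent p (x : Efibre G p) (xi : cotangent p) :
  Eform x (0, xi, 0) = 2^-1 * xi x.1.1.
Proof. by rewrite /Eform /= cotangent0 gform0r !addr0. Qed.

(** As pairing with a covector only sees the anchor, this is the skewness of J
    on T*M. *)
Lemma B_skew p (xi eta : cotangent p) :
  eta (B_component J xi) = - xi (B_component J eta).
Proof.
have /eqP := Jgac.1 p (0, xi, 0) (0, eta, 0).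
rewrite addr_eq0 Eform_cotangent Eform_sym Eform_cotangent -mulrN.
by rewrite (inj_eq (mulfI _)) ?invr_eq0 ?pnatr_eq0 // => /eqP.
Qed.

Lemma B_alt p (xi : cotangent p) : xi (B_component J xi) = 0.
Proof. by apply/eqP; rewrite -eqNr -B_skew. Qed.

Lemma B_linear p : linear (@B_component _ _ _ _ _ J p).
Proof.
move=> a xi eta; rewrite /B_component.
have -> : (0, a *: xi + eta, 0) =
    a *: ((0, xi, 0) : Efibre G p) + (0, eta, 0).
  by congr (_, _, _); rewrite /= scaler0 addr0.
by rewrite linearP.
Qed.

Lemma B_smooth (xi eta : oneform M) :
  smooth_on setT (fun p => eta p (B_component J (xi p))).
Proof.
have [v hv] := Eendo_smooth J (0, xi, 0).
have -> : (fun p => eta p (B_component J (xi p))) = (fun p => eta p (v.1.1 p)).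
  by apply/funext => p; rewrite /B_component -(hv p).
exact: oneformP.
Qed.

Definition B_bivector : bivector_field M :=
  @BivectorField _ _ M (fun p xi eta => eta (B_component J xi))
    (fun p eta a xi xi' =>
       etrans (congr1 eta (B_linear a xi xi')) (cotangentP eta a _ _))
    (fun p xi a eta eta' => erefl) B_alt B_smooth.

Lemma poisson_bracketC f g :
  poisson_bracket B_bivector f g = - poisson_bracket B_bivector g f.
Proof. by apply: Cinfty_ext => p; exact: B_skew. Qed.

(** v is the section J(df); its anchor v.1.1 is the Hamiltonian vector field
    of f. *)
Definition hamiltonian_lift f v : Prop :=
  forall p, Eval v p = J p (Eval (diffE G f) p).

Lemma poisson_bracketE f g v : hamiltonian_lift f v ->
  poisson_bracket B_bivector f g = vf_act v.1.1 g.
Proof. by move=> hv; apply: Cinfty_ext => p; rewrite /= /B_component -(hv p). Qed.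

Lemma hamiltonian_eigenbundle f v : hamiltonian_lift f v ->
  in_eigenbundle J (v, diffE G f).
Proof. by move=> hv p; rewrite /= hv Jgac.2. Qed.

(** [X_f, X_g] is the Hamiltonian vector field of X_f(g); stated on a function
    h, with B moved by skewness from the 1-form d(X_f(g)) onto dh. This form of
    the equation pairs d(X_f(g)) with a vector field only. *)
Lemma hamiltonian_bracket (E : standard_courant G) f g h u v w :
  gac_integrable E J ->
  hamiltonian_lift f u -> hamiltonian_lift g v -> hamiltonian_lift h w ->
  vf_act (lie_bracket u.1.1 v.1.1) h = - vf_act w.1.1 (vf_act u.1.1 g).
Proof.
move=> Jint hu hv hw; apply: Cinfty_ext => p.
have [_] :=
  Jint _ _ (hamiltonian_eigenbundle hu) (hamiltonian_eigenbundle hv) p.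
have [dr1 dr2 dr3] := dorfman_diffE_r E u g p.
have [dl1 dl2 dl3] := dorfman_diffE_l E v f p.
set zr := dorfman E u (diffE G g) in dr1 dr2 dr3 *.
set zl := dorfman E (diffE G f) v in dl1 dl2 dl3 *.
have -> : Eval (dorfmanC E (u, diffE G f) (v, diffE G g)).2 p =
    (0, zr.1.2 p + zl.1.2 p, 0).
  change ((zr.1.1 p + zl.1.1 p, zr.1.2 p + zl.1.2 p, zr.2 p + zl.2 p) =
          (0, zr.1.2 p + zl.1.2 p, 0)).
  by rewrite dr1 dl1 dr2 dl2 !addr0.
move=> /(congr1 (fun x : Efibre G p => diff_fun h p x.1.1)).
rewrite -/(B_component J (zr.1.2 p + zl.1.2 p)) B_skew.
have -> : B_component J (diff_fun h p) = w.1.1 p.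
  by rewrite /B_component -(hw p).
change (- (zr.1.2 p (w.1.1 p) + zl.1.2 p (w.1.1 p)) =
  (dorfman E u v).1.1 p h - (lie_bracket 0 0 p : tangent p) h ->
  (lie_bracket u.1.1 v.1.1 : vfield M) p h = - w.1.1 p (vf_act u.1.1 g)).
rewrite dr3 dl3 lie_bracket0r addr0 subr0 => ->.
by case: u {hu dr1 dr2 dr3 zr} => [[? ?] ?];
   case: v {hv dl1 dl2 dl3 zl} => [[? ?] ?].
Qed.

Lemma B_poisson (E : standard_courant G) :
  gac_integrable E J -> is_poisson B_bivector.
Proof.
move=> Jint f g h.
have [u hu] := Eendo_smooth J (diffE G f).
have [v hv] := Eendo_smooth J (diffE G g).
have [w hw] := Eendo_smooth J (diffE G h).
rewrite (poisson_bracketC h f) !(poisson_bracketE _ hu).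
rewrite !(poisson_bracketE _ hv) (poisson_bracketE _ hw) vf_actN.
by rewrite -vf_act_lie_bracket (hamiltonian_bracket Jint hu hv hw) addNr.
Qed.

End BComponent.

Theorem proposition3 (R : realType) (n k : nat) (M : manifold R n)
    (G : quadratic_bundle M k) (E : standard_courant G) (J : Eendo G) :
  connected [set: M]%classic ->
  neutral_signature G ->
  gen_almost_complex J ->
  gac_integrable E J ->
  exists B : bivector_field M,
    (forall (p : M) (xi eta : cotangent p),
       B p xi eta = eta (B_component J xi)) /\
    is_poisson B.
Proof.
move=> _ _ Jgac Jint; exists (B_bivector Jgac); split=> //.
exact: B_poisson Jint.
Qed.
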